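(* Let $\varepsilon>0$ be arbitrary. There exist a compact convex domain $\mathcal{Y}\subset\mathbb{R}^2$ and an i.i.d. sequence $a_1,a_2,\ldots$ of cost vectors in $\mathbb{R}^2$ with $\mathbb{E}[a_i]=a$ such that the actions $x_1,x_2,\ldots$ of the Anytime Subgradient Algorithm on $\mathcal{Y}$ with parameter $\eta=1$ satisfy $$\mathbb{E}\left[\sum_{i=1}^n a\cdot(x_i-x^* )\right]\ge\Omega\left(n^{1/2-\varepsilon}\right),$$ where $x^*\in\arg\min_{x\in\mathcal{Y}}a\cdot x$; that is, there are $c>0$ and $n_0\in\mathbb{N}$ such that the left-hand side is at least $c\,n^{1/2-\varepsilon}$ for all $n\ge n_0$.
   Context: For a compact convex set $\mathcal{X}\subset\mathbb{R}^d$, $P_{\mathcal{X}}(y)$ is the Euclidean projection of $y$ onto $\mathcal{X}$. Anytime Subgradient Algorithm on $\mathcal{X}$ with parameter $\eta>0$ and cost vectors $a_1,a_2,\ldots$: $x_1=P_{\mathcal{X}}(0)$, and for $n\ge2$, $x_n=P_{\mathcal{X}}(y_n)$ where $y_n=-\eta\,\frac{a_1+\cdots+a_{n-1}}{\sqrt{n-1}}$. *)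

(* Defs.v *)
From HB Require Import structures.
From mathcomp Require Import all_boot all_order all_algebra.
From mathcomp Require Import finmap all_classical all_reals all_analysis.

Set Implicit Arguments.
Unset Strict Implicit.
Unset Printing Implicit Defensive.

Import Order.TTheory GRing.Theory Num.Theory.
Import numFieldNormedType.Exports.

Local Open Scope classical_set_scope.
Local Open Scope ring_scope.

Section euclidean_space.
Context {R : realType} {k : nat}.
Implicit Types (u v x y p : 'rV[R]_k) (X : set 'rV[R]_k).

Definition dotp u v : R := \sum_(j < k) u ord0 j * v ord0 j.

(* The library norm on ['rV[R]_k] is the sup norm. It induces the Euclidean
   topology, so [open], [compact] and the Borel sets below are the usual ones,
   but projections need the Euclidean norm. *)
Definition enorm u : R := Num.sqrt (dotp u u).

Definition nearest_point X y p : Prop :=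
  X p /\ forall z, X z -> enorm (y - p) <= enorm (y - z).

(* [nearest_point X y] is a singleton when [X] is nonempty, compact and convex;
   if it is empty, the default value is [0]. *)
Definition proj X y : 'rV[R]_k := xget 0 (nearest_point X y).

Definition argmin_linear X (c : 'rV[R]_k) : set 'rV[R]_k :=
  [set x | X x /\ forall z, X z -> dotp c x <= dotp c z].

(* Sequences are indexed from 0: [a i] is a_{i+1} and
   [anytime_subgradient X eta a n] is x_{n+1}, which depends on a_1, ..., a_n. *)
Definition anytime_subgradient X (eta : R) (a : nat -> 'rV[R]_k) (n : nat) :
    'rV[R]_k :=
  if n is 0%N then proj X 0
  else proj X (- (eta *: ((Num.sqrt n%:R)^-1 *: \sum_(i < n) a i))).

Definition borel_vector : set (set 'rV[R]_k) := <<s @open 'rV[R]_k >>.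

End euclidean_space.

Section random_vectors.
Context {R : realType} {k : nat} {d : measure_display} {T : measurableType d}.
Variable P : probability T R.

Definition random_vector (X : T -> 'rV[R]_k) : Prop :=
  measurable_fun [set: T] (X : T -> g_sigma_algebraType (@open 'rV[R]_k)).

Definition mutually_independent (X : nat -> T -> 'rV[R]_k) : Prop :=
  forall (J : {fset nat}) (B : nat -> set 'rV[R]_k),
    (forall i, i \in J -> borel_vector (B i)) ->
    P (\bigcap_(i in [set` J]) (X i @^-1` B i)) =
    (\prod_(i <- J) P (X i @^-1` B i))%E.

Definition identically_distributed (X : nat -> T -> 'rV[R]_k) : Prop :=
  forall (i j : nat) (B : set 'rV[R]_k), borel_vector B ->
    P (X i @^-1` B) = P (X j @^-1` B).

Definition iid (X : nat -> T -> 'rV[R]_k) : Prop :=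
  [/\ forall i, random_vector (X i),
      mutually_independent X & identically_distributed X].

Definition has_mean (X : T -> 'rV[R]_k) (m : 'rV[R]_k) : Prop :=
  forall j : 'I_k,
    P.-integrable [set: T] (fun w => (X w ord0 j)%:E) /\
    ('E_P[fun w => X w ord0 j] = (m ord0 j)%:E)%E.

End random_vectors.

(* Main.v *)
Require Import Defs.
From HB Require Import structures.
From mathcomp Require Import all_boot all_order all_algebra.
From mathcomp Require Import finmap all_classical all_reals all_analysis.
From mathcomp Require Import ring lra.

Set Implicit Arguments.
Unset Strict Implicit.
Unset Printing Implicit Defensive.

Import Order.TTheory GRing.Theory Num.Theory.
Import numFieldNormedType.Exports.

Local Open Scope classical_set_scope.
Local Open Scope ring_scope.

(** The cost sequence can be taken deterministic: [a_i = (0, 1)] for all [i].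
The action after [n] steps is then the projection of [(0, - sqrt n)], i.e. the
minimizer over [Y] of [|z|^2 + 2 sqrt n * z_2], and the whole loss comes from
the slow decay of the height of this minimizer.

Take [Y = {(x, v) | 0 <= x <= 1, (1 - x) ^ (m + 1) <= v <= 1}].  The linear cost
is minimal at [(1, 0)], while the quadratic term pulls towards [x = 0].  Near
[(1, 0)] the lower boundary of [Y] is so flat that moving a distance [s] to the
left of [x = 1] costs only [sqrt n * s ^ (m + 1)] and gains an amount of order
[s].  Balancing the two gives [s] of order [n ^ (- 1 / (2 m))], hence a height
of at least [(s / 2) ^ (m + 1)] ([nearest_power_region_ge]).  The same [s]
serves all the steps before [n], as the pull towards the argmin only increases
with time; so the regret after [n] steps is at least [n (s / 2) ^ (m + 1)],
which is a constant times [n ^ (1/2 - 1 / (2 m))] ([powR_step_size]), and [m] is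
chosen with [1 / (2 m) <= eps]. *)

(** * Nearest points in compact sets *)

Section nearest_point.
Context {R : realType} {k : nat}.
Implicit Types (u y p : 'rV[R]_k) (X : set 'rV[R]_k).

Lemma dotp_continuous : continuous (fun u : 'rV[R]_k => dotp u u).
Proof.
apply: continuous_big => //; first by move=> x; exact: add_continuous.
by move=> j _ u; apply: continuousM; exact: coord_continuous.
Qed.

Lemma proj_nearest X y : X !=set0 -> compact X ->
  nearest_point X y (Defs.proj X y).
Proof.
move=> X0 cX; suff : nearest_point X y !=set0 by exact: xgetPex.
have cf : {within X, continuous (fun z => dotp (y - z) (y - z))}.
  apply: continuous_subspaceT => z.
  apply: (@continuous_comp _ _ _ (fun z : 'rV[R]_k => y - z)
                                 (fun u : 'rV[R]_k => dotp u u)).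
    by apply: continuousB; [exact: cst_continuous|exact: cvg_id].
  exact: dotp_continuous.
have [p /set_mem Xp pmin] := compact_EVT_min X0 cX cf.
by exists p; split=> // z /mem_set Xz; rewrite ler_wsqrtr// pmin.
Qed.

Lemma nearest_point_dotp X y p z : nearest_point X y p -> X z ->
  dotp (y - p) (y - p) <= dotp (y - z) (y - z).
Proof.
move=> [_ pmin] /pmin.
have d0 u : 0 <= dotp u u by apply: sumr_ge0 => j _; rewrite -expr2 sqr_ge0.
by rewrite /enorm ler_sqrt.
Qed.

End nearest_point.

(** * Constant cost sequences *)

Section constant_sequences.
Context {R : realType} {k : nat} {d : measure_display} {T : measurableType d}.
Implicit Types P : probability T R.

(** Both sides of the product rule are [1] if all the events contain the common
value, and [0] as soon as one of them does not. *)
Lemma iid_cst P (v : 'rV[R]_k) : iid P (fun _ _ => v).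
Proof.
split=> [i|J B _|//]; first exact: measurable_cst.
have [vB|] := pselect (forall i, i \in J -> B i v).
  rewrite big_seq big1 => [|i iJ]; last first.
    rewrite (_ : _ @^-1` _ = setT) ?probability_setT//.
    by rewrite -subTset => w _; exact: vB.
  rewrite (_ : \bigcap_(_ in _) _ = setT) ?probability_setT//.
  by rewrite -subTset => w _ i /=; exact: vB.
move=> /existsNP[i /not_implyP[iJ vBi]].
rewrite (big_fsetD1 i)//= (_ : _ @^-1` _ = set0); last by rewrite -subset0 => w.
rewrite measure0 mul0e (_ : \bigcap_(_ in _) _ = set0) ?measure0//.
by rewrite -subset0 => w /(_ i iJ).
Qed.

Lemma has_mean_cst P (v : 'rV[R]_k) : has_mean P (fun=> v) v.
Proof.
move=> j; split; last exact: expectation_cst.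
exact: (finite_measure_integrable_cst P (v ord0 j)).
Qed.

End constant_sequences.

Lemma anytime_subgradient_cst (R : realType) k (X : set 'rV[R]_k) (eta : R)
    v n :
  anytime_subgradient X eta (fun=> v) n =
  Defs.proj X (- ((eta * Num.sqrt n%:R) *: v)).
Proof.
case: n => [|n]; first by rewrite /= sqrtr0 mulr0 scale0r oppr0.
rewrite /anytime_subgradient sumr_const card_ord -(scaler_nat _ v) !scalerA.
have n0 : Num.sqrt (n.+1%:R : R) != 0 by rewrite sqrtr_eq0 -ltNge ltr0Sn.
have nE : (Num.sqrt n.+1%:R)^-1 * n.+1%:R = Num.sqrt n.+1%:R :> R.
  by rewrite -[X in _ * X]sqr_sqrtr ?ler0n// expr2 mulKf.
by rewrite -mulrA nE.
Qed.

(** * The region above a power function *)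

(** Convexity of powers on the nonnegative half-line.  The induction step
multiplies two weighted means and uses Chebyshev's inequality: [x ^ n] and [x]
are ordered alike, so the mean of their product exceeds the product of means. *)
Lemma exprn_conv_le (R : realDomainType) (l x y : R) n :
  0 <= l <= 1 -> 0 <= x -> 0 <= y ->
  (l * x + (1 - l) * y) ^+ n <= l * x ^+ n + (1 - l) * y ^+ n.
Proof.
move=> /andP[l0 l1] x0 y0; have l1' : 0 <= 1 - l by rewrite subr_ge0.
elim: n => [|n IHn]; first by rewrite !expr0 !mulr1 subrKC.
rewrite exprSr; apply: le_trans (ler_wpM2r _ IHn) _.
  by rewrite addr_ge0// mulr_ge0.
have chebyshev : 0 <= (x ^+ n - y ^+ n) * (x - y).
  have [xy|yx] := leP x y.
    by rewrite mulr_le0// subr_le0// lerXn2r.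
  by rewrite mulr_ge0// subr_ge0 ?lerXn2r ?nnegrE// ltW.
rewrite -subr_ge0 !exprSr
  [leRHS](_ : _ = l * (1 - l) * ((x ^+ n - y ^+ n) * (x - y))).
  exact: mulr_ge0 (mulr_ge0 l0 l1') chebyshev.
by ring.
Qed.

Section power_region.
Context {R : realType}.
Implicit Types (x v s t : R) (m : nat).

Definition vec2 x v : 'rV[R]_2 := \row_j (if j == ord0 then x else v).

Lemma dotp2 (p q : 'rV[R]_2) :
  dotp p q = p ord0 ord0 * q ord0 ord0 + p ord0 ord_max * q ord0 ord_max.
Proof.
have e : lift ord0 (ord0 : 'I_1) = ord_max :> 'I_2 by exact/val_inj.
by rewrite /dotp big_ord_recl big_ord1 e.
Qed.

Definition power_region m : set 'rV[R]_2 :=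
  [set p | [/\ 0 <= p ord0 ord0 <= 1, p ord0 ord_max <= 1 &
               (1 - p ord0 ord0) ^+ m <= p ord0 ord_max]].

Lemma power_region_boundary m s : 0 <= s <= 1 ->
  power_region m (vec2 (1 - s) (s ^+ m)).
Proof.
move=> /andP[s0 s1]; rewrite /power_region /= !mxE /= subKr.
by split; rewrite ?lexx ?exprn_ile1// subr_ge0 s1 gerBl.
Qed.

Lemma power_region_nonempty m : power_region m !=set0.
Proof.
exists (vec2 (1 - 0) (0 ^+ m)); apply: power_region_boundary.
by rewrite lexx ler01.
Qed.

Lemma power_region_compact m : compact (power_region m).
Proof.
have coord (j : 'I_2) : continuous (fun p : 'rV[R]_2 => p ord0 j).
  exact: coord_continuous.
have cube_compact : compact [set p : 'rV[R]_2 | forall j, p ord0 j \in `[0, 1]].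
  apply: (@rV_compact R 2 (fun=> [set` `[0, 1]])) => j.
  exact: segment_compact.
apply: (subclosed_compact _ cube_compact).
- rewrite (_ : power_region m =
    [set p | 0 <= p ord0 ord0] `&` [set p | p ord0 ord0 <= 1] `&`
    [set p | p ord0 ord_max <= 1] `&`
    [set p | 0 <= p ord0 ord_max - (1 - p ord0 ord0) ^+ m]); last first.
    apply/seteqP; split=> p /=; rewrite /power_region /= subr_ge0.
      by move=> [/andP[]].
    by move=> [[[-> ->]]].
  have ge_closed (f : 'rV[R]_2 -> R) :
      continuous f -> closed [set p | 0 <= f p].
    by move=> cf; apply: (preimage_closed _ (@closed_ge _ 0)) => p _; exact: cf.
  have le_closed (f : 'rV[R]_2 -> R) :
      continuous f -> closed [set p | f p <= 1].
    by move=> cf; apply: (preimage_closed _ (@closed_le _ 1)) => p _; exact: cf.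
  apply: closedI; [apply: closedI; [apply: closedI|]|].
  + exact: ge_closed.
  + exact: le_closed.
  + exact: le_closed.
  have pow_continuous : continuous (fun p : 'rV[R]_2 => (1 - p ord0 ord0) ^+ m).
    move=> p.
    apply: (@continuous_comp _ _ _ (fun p : 'rV[R]_2 => 1 - p ord0 ord0)
                                   (fun x : R => x ^+ m)).
      apply: (@continuousB _ R^o _ (cst 1) (fun p : 'rV[R]_2 => p ord0 ord0)).
        exact: cst_continuous.
      exact: coord.
    exact: exprn_continuous.
  apply: ge_closed => p.
  apply: (@continuousB _ R^o _ (fun p : 'rV[R]_2 => p ord0 ord_max)).
    exact: coord.
  exact: pow_continuous.
- move=> p [/andP[x0 x1] v1 xv] j; rewrite /= in_itv /=.
  have v0 : 0 <= p ord0 ord_max.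
    by apply: le_trans xv; rewrite exprn_ge0// subr_ge0.
  have [->|->] : j = ord0 \/ j = ord_max.
    by case: j => [[|[|//]] ?]; [left|right]; exact/val_inj.
  + by rewrite x0.
  + by rewrite v0.
Qed.

Lemma power_region_convex m : convex_set (power_region m).
Proof.
move=> p q l /set_mem[/andP[px0 px1] pv1 pxv] /set_mem[/andP[qx0 qx1] qv1 qxv].
apply/mem_set; rewrite /power_region /conv /= !mxE.
have l01 : 0 <= l%:num <= 1 by rewrite ge0 le1.
move: (l%:num) l01 => r r01.
have avg_ge0 a b : 0 <= a -> 0 <= b -> 0 <= r * a + (1 - r) * b by nra.
have avg_le1 a b : a <= 1 -> b <= 1 -> r * a + (1 - r) * b <= 1 by nra.
split; [by rewrite avg_ge0// avg_le1|exact: avg_le1|].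
set x := p ord0 ord0 in px0 px1 pxv *; set y := q ord0 ord0 in qx0 qx1 qxv *.
have -> : 1 - (r * x + (1 - r) * y) = r * (1 - x) + (1 - r) * (1 - y) by ring.
apply: le_trans (exprn_conv_le _ r01 _ _) _; rewrite ?subr_ge0//.
by have /andP[r0 r1] := r01; rewrite lerD// ler_wpM2l// subr_ge0.
Qed.

(** The competitor [(1 - s, s ^ (m + 1))] has squared distance at most
[t ^ 2 + 1 - s] to [(0, - t)]: the loss
[s ^ 2 + s ^ (2 m + 2) + 2 t s ^ (m + 1)] uses up at most half of the gain
[2 s].  A point of the region lower than [(s / 2) ^ (m + 1)] has abscissa above
[1 - s / 2], so its squared distance exceeds
[t ^ 2 + (1 - s / 2) ^ 2 >= t ^ 2 + 1 - s]. *)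
Lemma nearest_power_region_ge m s t p :
  nearest_point (power_region m.+1) (vec2 0 (- t)) p ->
  0 <= s <= 4^-1 -> 0 <= t -> t * s ^+ m <= 4^-1 ->
  (s / 2) ^+ m.+1 <= p ord0 ord_max.
Proof.
move=> near /andP[s0 s4] t0 ts.
have [[/andP[x0 x1] v1 xv] _] := near.
have Yz : power_region m.+1 (vec2 (1 - s) (s ^+ m.+1)).
  by apply: power_region_boundary; lra.
have := nearest_point_dotp near Yz.
rewrite !dotp2 !mxE /=.
move: x0 x1 v1 xv; set x := p ord0 ord0; set v := p ord0 ord_max.
move=> x0 x1 v1 xv dist.
have [//|vs] := leP ((s / 2) ^+ m.+1) v.
have v0 : 0 <= v by apply: le_trans xv; rewrite exprn_ge0// subr_ge0.
have xs : 1 - x < s / 2.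
  rewrite -(ltr_pXn2r (ltn0Sn m)) ?nnegrE ?subr_ge0// ?divr_ge0//.
  exact: le_lt_trans vs.
have ss : s ^+ m.+1 <= s by rewrite exprS ler_piMr// exprn_ile1//; lra.
have tss : t * s ^+ m.+1 <= s / 4.
  by rewrite exprS mulrCA ler_wpM2l.
have sm0 : 0 <= s ^+ m.+1 by rewrite exprn_ge0.
by nra.
Qed.

End power_region.

(** * Choice of the offset at a given horizon *)

(** For the horizon [x], [s] is the largest scale, up to a constant, at which
the competitor above is admissible: [s ^ m] is of the order of [x ^ (- 1 / 2)].
The last identity turns the per-step loss into the announced exponent. *)
Lemma powR_step_size (R : realType) m (x : R) :
  (0 < m)%N -> 1 <= x -> let s := 4^-1 * x `^ (- (2 * m%:R)^-1) in
  [/\ 0 <= s <= 4^-1, Num.sqrt x * s ^+ m <= 4^-1 &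
      x * (s / 2) ^+ m.+1 = (8^-1) ^+ m.+1 * x `^ (2^-1 - (2 * m%:R)^-1)].
Proof.
move=> m0 x1 s; have x0 : 0 < x by exact: lt_le_trans x1.
have xN0 : x != 0 by rewrite gt_eqF.
have mR0 : 0 < m%:R :> R by rewrite ltr0n.
set e := (2 * m%:R)^-1; have e0 : 0 < e by rewrite invr_gt0 mulr_gt0.
have em : e * m%:R = 2^-1 by rewrite /e; field; rewrite gt_eqF.
have sn k : s ^+ k = (4^-1) ^+ k * x `^ (- e * k%:R).
  by rewrite exprMn powRrM powR_mulrn// powR_ge0.
have pow1 : x `^ (- e) <= 1 by rewrite -(powRr0 x) ler_powR// oppr_le0 ltW.
split.
- by rewrite mulr_ge0 ?powR_ge0//= ler_piMr.
- rewrite -powR12_sqrt ?(ltW x0)// sn mulrCA -powRD; last first.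
    by rewrite xN0 implybT.
  rewrite mulNr em subrr powRr0 mulr1 -(prednK m0) exprS ler_piMr//.
  by rewrite exprn_ile1//; lra.
- rewrite exprMn sn mulrAC -exprMn mulrCA -{1}(powRr1 (ltW x0)).
  rewrite -powRD; last first.
    by rewrite xN0 implybT.
  congr (_ ^+ _ * _ `^ _); first by lra.
  by rewrite -natr1 mulrDr mulr1 mulNr em; lra.
Qed.

Theorem lemma4 (R : realType) (eps : R) (eps_gt0 : 0 < eps) :
  exists Y : set 'rV[R]_2,
    [/\ Y !=set0, compact Y & convex_set Y] /\
    exists (d : measure_display) (T : measurableType d) (P : probability T R)
           (a : nat -> T -> 'rV[R]_2) (abar : 'rV[R]_2),
      [/\ iid P a,
          forall i, has_mean P (a i) abar &
          forall xstar, argmin_linear Y abar xstar ->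
            exists c : R, 0 < c /\ exists n0 : nat, forall n : nat, (n0 <= n)%N ->
              ((c * n%:R `^ (2^-1 - eps))%:E <=
                'E_P[fun w => (\sum_(i < n)
                  dotp abar (anytime_subgradient Y 1 (a ^~ w) i - xstar))%R])%E].
Proof.
have [m m0 meps] : exists2 m, (0 < m)%N & (2 * m%:R)^-1 <= eps.
  exists (Num.truncn (2 * eps)^-1).+1 => //.
  have := truncnS_gt (2 * eps)^-1; set m : R := (Num.truncn _).+1%:R.
  rewrite invfM => epsm; have eV0 : 0 < eps^-1 by rewrite invr_gt0.
  by rewrite -[leRHS]invrK lef_pV2 ?posrE//; lra.
exists (power_region m.+1); split.
  split; [exact: power_region_nonempty|exact: power_region_compact|].
  exact: power_region_convex.
pose abar : 'rV[R]_2 := vec2 0 1.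
exists _, unit, (\d_tt : probability unit R), (fun _ _ => abar), abar.
split=> [|i|xstar [_ xstar_min]]; [exact: iid_cst|exact: has_mean_cst|].
have abarE (q : 'rV[R]_2) : dotp abar q = q ord0 ord_max.
  by rewrite dotp2 !mxE /= mul0r add0r mul1r.
(* Only the value of the cost at [xstar] matters; compare it with [(1, 0)]. *)
have xstar_le0 : xstar ord0 ord_max <= 0.
  have /xstar_min : power_region m.+1 (vec2 (1 - 0) (0 ^+ m.+1) : 'rV[R]_2).
    by apply: power_region_boundary; rewrite lexx ler01.
  by rewrite !abarE !mxE /= expr0n.
exists ((8^-1) ^+ m.+1); split; first by rewrite exprn_gt0.
exists 1%N => n n1; rewrite [X in (_ <= X)%E]expectation_cst lee_fin.
have nR1 : 1 <= n%:R :> R by rewrite ler1n.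
have [s_itv ts sE] := powR_step_size m0 nR1.
set s := 4^-1 * _ in s_itv ts sE.
apply: (@le_trans _ _ (n%:R * (s / 2) ^+ m.+1)).
  by rewrite sE ler_wpM2l ?exprn_ge0// ler_powR// lerD2l lerN2.
rewrite mulr_natl -[X in _ *+ X]card_ord -sumr_const; apply: ler_sum => i _.
rewrite anytime_subgradient_cst abarE !mxE mul1r.
apply: (@le_trans _ _ (Defs.proj (power_region m.+1)
    (vec2 0 (- Num.sqrt i%:R)) ord0 ord_max)).
  apply: (@nearest_power_region_ge _ _ _ (Num.sqrt i%:R)) => //.
    apply: proj_nearest; first exact: power_region_nonempty.
    exact: power_region_compact.
  (* The offset chosen for the horizon [n] is admissible at every step. *)
  apply: le_trans ts; rewrite ler_wpM2r ?exprn_ge0//; first by case/andP: s_itv.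
  by rewrite ler_wsqrtr// ler_nat ltnW.
rewrite (_ : - (_ *: abar) = vec2 0 (- Num.sqrt i%:R)).
  by rewrite lerDl oppr_ge0.
by apply/rowP => j; rewrite !mxE; case: ifP => _; rewrite ?mulr0 ?oppr0 ?mulr1.
Qed.
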